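(* The permutation class $\mathrm{Av}(132)$ is unsplittable.
   Context: A permutation of order $n\ge 1$ is a sequence of the $n$ distinct numbers of $[n]=\{1,\dots,n\}$ (permutations are nonempty). A permutation $\pi$ contains a permutation $\sigma$ if $\pi$ has a subsequence order-isomorphic to $\sigma$; otherwise $\pi$ avoids $\sigma$. $\mathrm{Av}(\sigma)$ is the set of all $\sigma$-avoiding permutations. A permutation class is a set of permutations closed under taking contained permutations. For permutation classes $P_1,\dots,P_m$, let $P_1\odot\dots\odot P_m$ be the set of all permutations whose entries can be colored by $m$ colors so that for each $i$ the subsequence of color $i$ is either empty or order-isomorphic to an element of $P_i$. A multiset $\{P_1,\dots,P_m\}$ of permutation classes is a splitting of a class $C$ if $C\subseteq P_1\odot\dots\odot P_m$; the $P_i$ are its parts. The splitting is nontrivial if no part is a superset of $C$. A class is splittable if it has a nontrivial splitting, and unsplittable otherwise. *)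

(* Defs.v *)
From HB Require Import structures.
From mathcomp Require Import all_boot.
From mathcomp Require Import classical_sets.
Set Implicit Arguments.
Unset Strict Implicit.
Unset Printing Implicit Defensive.

Local Open Scope classical_set_scope.
Local Open Scope nat_scope.

(* One-line notation: a nonempty sequence listing 1, ..., n once each. *)
Definition is_permutation (s : seq nat) : bool :=
  (s != [::]) && perm_eq s (iota 1 (size s)).

Record permutation := Permutation {
  perm_seq :> seq nat;
  _ : is_permutation perm_seq }.

HB.instance Definition _ := [isSub for perm_seq].
HB.instance Definition _ := [Choice of permutation by <:].

Definition order_iso (s t : seq nat) : Prop :=
  size s = size t /\
  forall i j, i < size s -> j < size s ->
    (nth 0 s i < nth 0 s j) = (nth 0 t i < nth 0 t j).

Definition contains (p q : permutation) : Prop :=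
  exists2 t : seq nat, subseq t p & order_iso t q.

Record perm_class := PermClass {
  class_set :> set permutation;
  class_closed : forall p q, class_set p -> contains p q -> class_set q }.

(* The entries of a permutation are distinct, so a coloring of the entries is
   given by a color c x for each value x; the colors of numbers that do not
   occur in p are irrelevant. *)
Definition odot (m : nat) (P : 'I_m -> perm_class) : set permutation :=
  [set p | exists c : nat -> 'I_m, forall i : 'I_m,
     let s := [seq x <- p | c x == i] in
     s = [::] \/ exists2 q : permutation, class_set (P i) q & order_iso s q].

(* A multiset of m classes is given by an indexed family. *)
Definition splitting (C : perm_class) (m : nat) (P : 'I_m -> perm_class) :
    Prop :=
  C `<=` odot P.

Definition nontrivial (C : perm_class) (m : nat) (P : 'I_m -> perm_class) :
    Prop :=
  forall i, ~ (C `<=` P i).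

Definition splittable (C : perm_class) : Prop :=
  exists m, exists P : 'I_m -> perm_class, splitting C P /\ nontrivial C P.

Definition unsplittable (C : perm_class) : Prop := ~ splittable C.

Lemma order_iso_trans s t u : order_iso s t -> order_iso t u -> order_iso s u.
Proof.
move=> [st Hst] [tu Htu]; split=> [|i j si sj]; first by rewrite st.
by rewrite Hst // Htu // -st.
Qed.

Lemma order_iso_mask m s t :
  order_iso s t -> order_iso (mask m s) (mask m t).
Proof.
move=> [st Hst].
have maskE (u : seq nat) : size u = size s ->
    mask m u = [seq nth 0 u i | i <- mask m (iota 0 (size s))].
  move=> us; rewrite map_mask; congr mask.
  by rewrite -us; symmetry; apply: (mkseq_nth 0 u).
rewrite (maskE s) // (maskE t) //; split=> [|i j]; first by rewrite !size_map.
rewrite size_map => si sj; rewrite !(nth_map 0) //.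
have lt_nth k : k < size (mask m (iota 0 (size s))) ->
    nth 0 (mask m (iota 0 (size s))) k < size s.
  by move=> /(mem_nth 0)/mem_mask; rewrite mem_iota.
by apply: Hst; apply: lt_nth.
Qed.

Lemma contains_trans p q r : contains p q -> contains q r -> contains p r.
Proof.
move=> [t tp tq] [u /subseqP[m _ ->] ur]; exists (mask m t).
  exact: subseq_trans (mask_subseq m t) tp.
exact: order_iso_trans (order_iso_mask m tq) ur.
Qed.

Lemma avoid_closed (s p q : permutation) :
  ~ contains p s -> contains p q -> ~ contains q s.
Proof. by move=> nps pq qs; apply: nps; apply: contains_trans pq qs. Qed.

Definition Av (s : permutation) : perm_class :=
  @PermClass [set p | ~ contains p s] (@avoid_closed s).

Definition perm132 : permutation := @Permutation [:: 1; 3; 2] isT.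

(* Main.v *)
(**
  If each part P_i misses some p_i in Av(132), it is enough to find a
  132-avoider such that every m-coloring of it has, for some i, a copy of p_i
  in color i.  A nonempty 132-avoider is L x R, where x is its maximum and all
  entries of R lie below those of L.  Induct on the total size of the p_i.
  If some p_i has R nonempty, take the skew sum of a sequence forcing the family
  with p_i replaced by L x and of one forcing it with p_i replaced by R: if both
  yield color i, the two copies fit together.  Otherwise every p_i is L_i x_i:
  take the skew sum over i of sequences forcing the family with p_i replaced by
  L_i, and append a new maximum; if its color is i, it extends a copy of L_i.
*)
From mathcomp Require Import all_boot.
From mathcomp Require Import boolp classical_sets.
Require Import Defs.
Set Implicit Arguments.
Unset Strict Implicit.
Unset Printing Implicit Defensive.

Local Open Scope nat_scope.

(** * Order isomorphism of concatenated sequences *)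

Lemma order_iso_size s t : order_iso s t -> size s = size t.
Proof. by case. Qed.

Lemma order_iso_sym s t : order_iso s t -> order_iso t s.
Proof. by case=> st H; split=> // i j; rewrite -st => si sj; rewrite H. Qed.

Lemma order_iso_map (f : nat -> nat) s :
  {in s &, {mono f : x y / x < y}} -> order_iso s [seq f x | x <- s].
Proof.
move=> fmono; split=> [|i j si sj]; first by rewrite size_map.
by rewrite !(nth_map 0) // fmono ?mem_nth.
Qed.

(** One boolean serves both sums: [true] gives the direct sum, [false] the skew sum. *)
Definition separated (b : bool) (s t : seq nat) : bool :=
  allrel (fun x y => if b then x < y else y < x) s t.

Lemma order_iso_cat b s1 s2 t1 t2 :
  separated b s1 s2 -> separated b t1 t2 ->
  order_iso s1 t1 -> order_iso s2 t2 -> order_iso (s1 ++ s2) (t1 ++ t2).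
Proof.
move=> /allrelP seps /allrelP sept [sz1 H1] [sz2 H2].
split=> [|i j]; first by rewrite !size_cat sz1 sz2.
rewrite size_cat !nth_cat -sz1 => si sj.
case: (ltnP i (size s1)) => i1; case: (ltnP j (size s1)) => j1.
- exact: H1.
- have j2 : j - size s1 < size s2 by rewrite ltn_subLR.
  have := seps _ _ (mem_nth 0 i1) (mem_nth 0 j2).
  rewrite sz1 in i1; have j2' := j2; rewrite sz2 in j2'.
  have := sept _ _ (mem_nth 0 i1) (mem_nth 0 j2').
  by case: (b) => [-> -> // | /ltnW + /ltnW]; rewrite !ltnNge => -> ->.
- have i2 : i - size s1 < size s2 by rewrite ltn_subLR.
  have := seps _ _ (mem_nth 0 j1) (mem_nth 0 i2).
  rewrite sz1 in j1; have i2' := i2; rewrite sz2 in i2'.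
  have := sept _ _ (mem_nth 0 j1) (mem_nth 0 i2').
  by case: (b) => [/ltnW + /ltnW | -> -> //]; rewrite !ltnNge => -> ->.
- by apply: H2; rewrite ltn_subLR.
Qed.

(** * Avoidance of 132 and the structure of avoiders *)

Fixpoint avoid132 (s : seq nat) : bool :=
  if s is x :: s' then pairwise (fun y z => ~~ (x < z < y)) s' && avoid132 s'
  else true.

Lemma pairwise_subseq (r : rel nat) s :
  (forall y z, subseq [:: y; z] s -> r y z) -> pairwise r s.
Proof.
elim: s => [|a s IH] //= H; apply/andP; split.
  by apply/allP => z zs; apply: H; rewrite eqxx sub1seq.
by apply: IH => y z yz; apply: H; apply: subseq_trans yz (subseq_cons _ _).
Qed.

Lemma avoid132P s :
  reflect (forall x y z, subseq [:: x; y; z] s -> ~~ (x < z < y)) (avoid132 s).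
Proof.
elim: s => [|a s IH]; first by apply: ReflectT.
apply: (iffP andP) => [[pa /IH H] x y z | H] /=.
  case: eqP => [-> yz | _ /H //].
  by have := subseq_pairwise yz pa; rewrite /= !andbT.
split; first by apply: pairwise_subseq => y z yz; apply: H; rewrite /= eqxx.
apply/IH => x y z xyz; apply: H.
exact: subseq_trans xyz (subseq_cons _ _).
Qed.

Lemma avoid132_subseq s t : subseq t s -> avoid132 s -> avoid132 t.
Proof.
move=> ts /avoid132P H; apply/avoid132P => x y z xyz.
by apply: H; apply: subseq_trans xyz ts.
Qed.

Lemma avoid132_map (f : nat -> nat) s :
  {in s &, {mono f : x y / x < y}} -> avoid132 [seq f x | x <- s] = avoid132 s.
Proof.
elim: s => [|a s IH] //= fmono.
have sub : {subset s <= a :: s} by move=> x xs; rewrite inE xs orbT.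
rewrite IH => [|x y xs ys]; last by rewrite fmono ?sub.
congr andb; rewrite pairwise_map.
apply: (@eq_in_pairwise _ [in s]); last by apply/allP.
by move=> y z ys zs /=; rewrite !fmono ?mem_head ?sub.
Qed.

(** Links containment to a test that also applies to blocks of a permutation and to sequences with
    gaps in their values. *)
Lemma contains132 (p : permutation) : contains p perm132 <-> ~~ avoid132 p.
Proof.
split=> [[t tp tiso] | ].
  apply/negP => /avoid132P av; have := order_iso_size tiso.
  case: t tp tiso => [|x [|y [|z [|]]]] //= /av av' [_ H] _.
  have := H 0 2 isT isT; have := H 2 1 isT isT => /= zy xz.
  by move: av'; rewrite xz zy.
move=> nav; apply: contrapT => ncont; case/negP: nav.
apply/avoid132P => x y z xyz; apply/negP => /andP[xz zy]; apply: ncont.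
exists [:: x; y; z] => //; split=> //.
have xy := ltn_trans xz zy.
by case=> [|[|[|]]] // [|[|[|]]] // _ _ /=; rewrite ?ltnn ?xz ?zy ?xy //;
  rewrite ltnNge ltnW.
Qed.

(** A 132 meeting both blocks has its 1 in [s1] and its 2 in [s2]. In a skew sum the 2 would lie
    below the 1. In a direct sum the 3, being larger than the 2, would also lie in [s2], which is
    too short. *)
Lemma avoid132_cat b s1 s2 :
  separated b s1 s2 -> (b -> size s2 <= 1) ->
  avoid132 s1 -> avoid132 s2 -> avoid132 (s1 ++ s2).
Proof.
move=> sep szb; elim: s1 sep => [|x s1 IH] //=.
rewrite /separated allrel_consl => /andP[/allP xs2 sep] /andP[px a1] a2.
rewrite IH // andbT pairwise_cat px /=; apply/andP; split.
  apply/allrelP => y z y1 z2; rewrite negb_and -!leqNgt.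
  case: b {szb IH} xs2 sep => xs2 /allrelP/(_ y z y1 z2) yz.
    by rewrite (ltnW yz) orbT.
  by rewrite (ltnW (xs2 z z2)).
case: b {IH sep} szb xs2 => [/(_ isT) | _ xs2].
  by case: s2 {a2} => [|y [|]].
apply/(pairwiseP 0) => i j _ j2 _.
by rewrite negb_and -leqNgt (ltnW (xs2 _ (mem_nth 0 j2))).
Qed.

Lemma seq_max (s : seq nat) :
  s != [::] -> exists2 x, x \in s & forall y, y \in s -> y <= x.
Proof.
elim: s => [|a [|b s] IH] // _.
  by exists a => [|y]; rewrite ?inE // => /eqP->.
case: IH => // x xs xmax; case: (leqP a x) => ax.
  by exists x => [|y]; rewrite in_cons ?xs ?orbT // => /predU1P[-> // | /xmax].
exists a => [|y]; rewrite in_cons ?eqxx // => /predU1P[-> // | /xmax yx].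
exact: leq_trans yx (ltnW ax).
Qed.

Lemma avoid132_split s :
  uniq s -> avoid132 s -> s != [::] ->
  exists L x R,
    [/\ s = rcons L x ++ R, separated true L [:: x]
      & separated false (rcons L x) R].
Proof.
move=> us av /seq_max[x xs xmax].
case/splitPr: xs us av xmax => L R us /avoid132P av xmax.
exists L, x, R; rewrite cat_rcons.
have lt_x y : y \in L ++ R -> y < x.
  move=> yLR; rewrite ltn_neqAle xmax; last first.
    by move: yLR; rewrite !mem_cat inE => /orP[->|->]; rewrite ?orbT.
  rewrite andbT; apply: contraTneq yLR => ->.
  by move: us; rewrite uniq_catC /= mem_cat orbC -mem_cat => /andP[].
split=> //; apply/allrelP => y z.
  by rewrite inE => yL /eqP->; apply: lt_x; rewrite mem_cat yL.
move=> yLx zR; have zx : z < x by rewrite lt_x // mem_cat zR orbT.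
move: yLx; rewrite mem_rcons inE => /orP[/eqP-> // | yL].
(* An entry [z] after the maximum and above an earlier [y] would make [y], [x], [z] a 132; equality
   is excluded by [uniq]. *)
have /av : subseq [:: y; x; z] (L ++ x :: R).
  by rewrite -cat1s cat_subseq ?sub1seq //= eqxx sub1seq.
rewrite zx andbT -leqNgt leq_eqVlt => /orP[/eqP zy | //].
move: us; rewrite cat_uniq => /and3P[_ /hasPn/(_ z)].
by rewrite inE zR orbT zy yL => /(_ isT).
Qed.

(** * Occurrences of patterns in color classes *)

Definition occurs (p s : seq nat) : Prop :=
  exists2 t, subseq t s & order_iso t p.

Lemma occurs_subseq p s t : subseq s t -> occurs p s -> occurs p t.
Proof. by move=> st [u us up]; exists u => //; apply: subseq_trans us st. Qed.

Lemma occurs_cat b p1 p2 s1 s2 :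
  separated b p1 p2 -> separated b s1 s2 ->
  occurs p1 s1 -> occurs p2 s2 -> occurs (p1 ++ p2) (s1 ++ s2).
Proof.
move=> sepp /allrelP seps [t1 ts1 tp1] [t2 ts2 tp2].
exists (t1 ++ t2); first exact: cat_subseq.
apply: (order_iso_cat _ sepp) => //; apply/allrelP => x y xt yt.
by apply: seps; [apply: mem_subseq xt | apply: mem_subseq yt].
Qed.

Section Forcing.

Variable I : finType.
Implicit Types (p : I -> seq nat) (s : seq nat) (c : nat -> I) (i : I).

Definition color_class c i s := [seq x <- s | c x == i].

Definition forces p s : Prop :=
  forall c, exists i, occurs (p i) (color_class c i s).

Lemma separated_color_class b c i s t :
  separated b s t -> separated b (color_class c i s) (color_class c i t).
Proof.
move=> /allrelP H; apply/allrelP => x y.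
by rewrite !mem_filter => /andP[_ xs] /andP[_ yt]; apply: H.
Qed.

Lemma forces_subseq p s t : subseq s t -> forces p s -> forces p t.
Proof.
move=> st fs c; have [i o] := fs c; exists i; apply: occurs_subseq o.
rewrite subseq_filter filter_all.
exact: subseq_trans (filter_subseq _ _) st.
Qed.

Definition wf b s := [&& uniq s, avoid132 s & all (leq b) s].

(** Serves both as the lower bound for a block placed above [s] and as a new maximum appended to
    [s]. Including [b] keeps it above [b] even when [s] is empty. *)
Definition bound b s := (\max_(x <- b :: s) x).+1.

Lemma ge_bound b s x : bound b s <= x -> b <= x /\ all (gtn x) s.
Proof.
move=> bx; have lt_x y : y \in b :: s -> y < x.
  by move=> ys; apply: leq_trans bx; rewrite ltnS; apply: leq_bigmax_seq ys _.
split; first by rewrite ltnW ?lt_x ?mem_head.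
by apply/allP => y ys; apply: lt_x; rewrite inE ys orbT.
Qed.

Lemma separated_bound b s1 s2 :
  all (leq (bound b s2)) s1 -> separated false s1 s2.
Proof.
by move=> /allP H; apply/allrelP => x y /H/ge_bound[_ /allP]; apply.
Qed.

Lemma wf_skew b s1 s2 : wf b s2 -> wf (bound b s2) s1 -> wf b (s1 ++ s2).
Proof.
case/and3P=> u2 a2 b2 /and3P[u1 a1 b1]; have sep := separated_bound b1.
apply/and3P; split.
- rewrite cat_uniq u1 u2 andbT; apply/hasPn => x xs2; apply/negP => xs1.
  by have /allrelP/(_ x x xs1 xs2) := sep; rewrite ltnn.
- exact: (@avoid132_cat false).
- rewrite all_cat b2 andbT; apply/allP => x /(allP b1).
  by case/ge_bound.
Qed.

Lemma wf_rcons b s : wf b s -> wf b (rcons s (bound b s)).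
Proof.
case/and3P=> u a bs; have [bB sB] := ge_bound (leqnn (bound b s)).
rewrite /wf rcons_uniq u all_rcons bB bs !andbT; apply/andP; split.
  by apply/negP => /(allP sB) /=; rewrite ltnn.
by rewrite -cats1 (@avoid132_cat true) // /separated allrel1r.
Qed.

(* The lower bound b replaces shifting when attaining sequences are combined. *)
Definition attainable p : Prop := forall b, exists2 s, wf b s & forces p s.

(** The skew sum of one sequence per index contains each of them, and forcing passes to
    supersequences. *)
Lemma attainable_all (q : I -> I -> seq nat) (r : seq I) :
  (forall i, attainable (q i)) ->
  forall b, exists2 s, wf b s & forall i, i \in r -> forces (q i) s.
Proof.
move=> att b; elim: r => [|i r [s2 w2 f2]]; first by exists [::].
have [s1 w1 f1] := att i (bound b s2); exists (s1 ++ s2); first exact: wf_skew.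
move=> j; rewrite inE => /orP[/eqP-> | /f2].
  exact: forces_subseq (prefix_subseq _ _) f1.
exact: forces_subseq (suffix_subseq _ _).
Qed.

Lemma attainable_skew p i (p1 p2 : seq nat) :
  p i = p1 ++ p2 -> separated false p1 p2 ->
  attainable [eta p with i |-> p1] -> attainable [eta p with i |-> p2] ->
  attainable p.
Proof.
move=> pi sep att1 att2 b; have [s2 w2 f2] := att2 b.
have [s1 w1 f1] := att1 (bound b s2); exists (s1 ++ s2); first exact: wf_skew.
move=> c; have [j1 /=] := f1 c; have [j2 /=] := f2 c.
rewrite /color_class.
(* A color other than [i] settles the goal at once, as its pattern is unchanged. *)
case: (eqVneq j2 i) => [-> | ne2] o2; last first.
  exists j2; apply: occurs_subseq o2.
  by rewrite filter_cat suffix_subseq.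
case: (eqVneq j1 i) => [-> | ne1] o1; last first.
  exists j1; apply: occurs_subseq o1.
  by rewrite filter_cat prefix_subseq.
exists i; rewrite pi filter_cat; apply: occurs_cat sep _ o1 o2.
by apply: separated_color_class; case/and3P: w1 => _ _ /separated_bound.
Qed.

Lemma attainable_rcons p (L : I -> seq nat) (x : I -> nat) :
  (forall i, p i = rcons (L i) (x i)) ->
  (forall i, separated true (L i) [:: x i]) ->
  (forall i, attainable [eta p with i |-> L i]) -> attainable p.
Proof.
move=> pE sep att b; have [s w f] := attainable_all (enum I) att b.
have [_ sB] := ge_bound (leqnn (bound b s)).
exists (rcons s (bound b s)); first exact: wf_rcons.
(* The color of the new maximum is known only after the coloring is given, so [s] forces the
   modified families for all indices at once. *)
move=> c; set i := c (bound b s).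
have [j /=] := f i (mem_enum _ _) c; rewrite /color_class.
case: (eqVneq j i) => [-> | ne] o; last first.
  by exists j; apply: occurs_subseq o; rewrite -cats1 filter_cat prefix_subseq.
exists i; rewrite pE -!cats1 filter_cat /= eqxx.
apply: occurs_cat (sep i) _ o _; last first.
  exists [:: bound b s] => //; split=> // -[|//] [|//] _ _ /=.
  by rewrite !ltnn.
apply/allrelP => y z; rewrite mem_filter inE => /andP[_ ys] /eqP->.
exact: (allP sB).
Qed.

Lemma sum_size_update p i t :
  size t < size (p i) ->
  \sum_j size ([eta p with i |-> t] j) < \sum_j size (p j).
Proof.
move=> lt; rewrite (bigD1 i) //= (bigD1 (F := fun j => size (p j)) i) //= eqxx.
rewrite -addSn leq_add //; apply: leq_sum => j /negPf-> //.
Qed.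

Lemma avoid132_attainable p :
  (forall i, uniq (p i) && avoid132 (p i)) -> attainable p.
Proof.
have [n] := ubnP (\sum_j size (p j)); elim: n p => // n IH p le_n av.
(* An empty pattern occurs in every color class, so the empty sequence already forces the family. *)
case: (pselect (exists i, p i = [::])) => [[i pi] b | nonempty].
  by exists [::] => // c; exists i; rewrite pi; exists [::].
have IHi i t : size t < size (p i) -> subseq t (p i) ->
    attainable [eta p with i |-> t].
  move=> lt sub; apply: IH => [|j /=].
    by rewrite -ltnS; apply: leq_trans le_n; rewrite ltnS sum_size_update.
  case: eqP => _; last exact: av.
  have /andP[u a] := av i.
  by rewrite (subseq_uniq sub u) (avoid132_subseq sub a).
have split_p i : exists LxR : seq nat * nat * seq nat,
    let: (L, x, R) := LxR in
    [/\ p i = rcons L x ++ R, separated true L [:: x]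
      & separated false (rcons L x) R].
  have /andP[u a] := av i.
  case: (avoid132_split u a) => [|L [x [R H]]]; last by exists (L, x, R).
  by apply/eqP => pi; apply: nonempty; exists i.
(* In a proper skew sum both blocks are shorter than [p i]: the first because [R] is nonempty, the
   second because it misses [x]. *)
case: (pselect (exists i L x R, [/\ p i = rcons L x ++ R,
    separated false (rcons L x) R & R <> [::]])) => [|noR].
  move=> [i [L [x [R [pi sep /eqP Rn]]]]]; apply: (attainable_skew pi sep).
    apply: IHi; rewrite pi ?prefix_subseq // size_cat.
    by rewrite -ltn_subLR // subnn lt0n size_eq0.
  apply: IHi; rewrite pi ?suffix_subseq // size_cat size_rcons.
  by rewrite addSn ltnS leq_addl.
have [f fP] := choice split_p.
have R0 i : (f i).2 = [::].
  apply: contrapT => Rn; apply: noR; exists i, (f i).1.1, (f i).1.2, (f i).2.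
  by have := fP i; case: (f i) Rn => [[L x] R] Rn [].
have pE i : p i = rcons (f i).1.1 (f i).1.2.
  have := fP i; have := R0 i.
  by case: (f i) => [[L x] R] /= -> [-> _ _]; rewrite cats0.
apply: (attainable_rcons pE) => i.
  by have := fP i; case: (f i) => [[L x] R] [].
by apply: IHi; rewrite pE ?size_rcons // -cats1 prefix_subseq.
Qed.

End Forcing.

(** * Standardization of sequences and the theorem *)

Definition rank (s : seq nat) (x : nat) : nat := count (geq x) s.

Lemma rank_mono s : {in s &, {mono rank s : x y / x < y}}.
Proof.
have rank_le x y : x <= y -> rank s x <= rank s y.
  by move=> xy; apply: sub_count => z /= zx; apply: leq_trans zx xy.
move=> x y xs ys; apply/idP/idP.
  by apply: contraTT; rewrite -!leqNgt; apply: rank_le.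
(* Strictness comes from the entry [y] itself, which is counted for [y] but not for [x]. *)
move=> xy; rewrite /rank !(permP (perm_to_rem ys)) /=.
rewrite leqnn (leqNgt y x) xy add0n.
rewrite add1n ltnS; apply: sub_count => z /= zx.
exact: leq_trans zx (ltnW xy).
Qed.

Lemma rank_inj s : {in s &, injective (rank s)}.
Proof.
move=> x y xs ys rxy; apply/eqP; rewrite eqn_leq (leqNgt x y) (leqNgt y x).
by rewrite -(rank_mono xs ys) -(rank_mono ys xs) rxy ltnn.
Qed.

(** Each entry counts itself, so ranks start at 1. They are distinct and at most the size, hence
    they exhaust the interval. *)
Lemma is_permutation_rank s :
  uniq s -> s != [::] -> is_permutation [seq rank s x | x <- s].
Proof.
move=> us sn; rewrite /is_permutation -!size_eq0 size_map size_eq0 sn /=.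
have ur : uniq [seq rank s x | x <- s] by rewrite (map_inj_in_uniq (@rank_inj s)).
apply: uniq_perm => //; first exact: iota_uniq.
have [|//|//] := uniq_min_size (s2 := iota 1 (size s)) ur.
  move=> _ /mapP[x xs ->]; rewrite mem_iota add1n ltnS count_size andbT.
  by rewrite -has_count; apply/hasP; exists x => //=.
by rewrite size_iota size_map.
Qed.

Theorem proposition2p7 : unsplittable (Av perm132).
Proof.
move=> [m [P [split nontriv]]].
have ex_target i : exists p : permutation, avoid132 p /\ ~ class_set (P i) p.
  have [p [pav pP]] := nonsubset (nontriv i).
  by exists p; split=> //; apply/negPn/negP => /contains132.
have [p pP] := choice ex_target.
(* With no colors, even the permutation of order 1 has no coloring. *)
have [i0] : inhabited 'I_m.
  have [|c _] := split (@Permutation [:: 1] isT); last by exists; exact: c 0.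
  by apply/contains132.
have pn i : perm_seq (p i) != [::] by case: (p i) => q /= /andP[].
have [|s] := @avoid132_attainable 'I_m (fun i => p i) _ 0.
  move=> i; rewrite (proj1 (pP i)) andbT.
  by case: (p i) => q /= /andP[_ /perm_uniq->]; rewrite iota_uniq.
case/and3P=> us avs _ fs.
have sn : s != [::].
  apply/eqP => s0; have [i [t]] := fs (fun=> i0).
  rewrite s0 /color_class /= => /eqP-> /order_iso_size /esym/size0nil pi.
  by have := pn i; rewrite pi.
pose q := Permutation (is_permutation_rank us sn).
have [|c cP] := split q.
  by apply/contains132; rewrite /= avoid132_map ?avs //; apply: rank_mono.
(* The coloring of the standardized [q] is pulled back to [s], where forcing applies. *)
have [i [t ts tp]] := fs (c \o rank s).
have ts' : subseq [seq rank s x | x <- t] [seq x <- q | c x == i].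
  by rewrite /= filter_map map_subseq.
have {}tp : order_iso [seq rank s x | x <- t] (p i).
  apply: order_iso_trans tp; apply: order_iso_sym; apply: order_iso_map.
  have tq := mem_subseq ts.
  move=> x y /tq + /tq; rewrite !mem_filter => /andP[_ xs] /andP[_ ys].
  exact: rank_mono.
case: (cP i) => [nil_i | [r Pr cr]].
  move: ts'; rewrite nil_i => /eqP t0; move/order_iso_size: tp; rewrite t0.
  by move/esym/size0nil => pi; have := pn i; rewrite pi.
(* The mask that cuts the copy of [p i] out of color class [i] is applied to the isomorphic [r] in
   [P i]; closure then puts [p i] in [P i], a contradiction. *)
case/subseqP: ts' tp => k _ -> tp; case: (pP i) => _; apply.
apply: (class_closed Pr); exists (mask k r); first exact: mask_subseq.
exact: order_iso_trans (order_iso_mask k (order_iso_sym cr)) tp.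
Qed.
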